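(* Let $G$ be a connected graph of order $n$ with $m$ edges and $p$ pendent vertices. Then \[ AG(G) \le \frac{1}{2}p\,\frac{n}{\sqrt{n-1}} + \frac{1}{2}(m-p)\left(\sqrt{\frac{n-1}{2}} + \sqrt{\frac{2}{n-1}}\right), \] with equality if and only if $G$ is isomorphic to the star $K_{1,n-1}$ or to the complete graph $K_3$.
   Context: All graphs are finite, simple and undirected. $d_i$ is the degree of vertex $v_i$; $i\sim j$ denotes an edge $v_iv_j$ and sums over $i\sim j$ run over edges, each once. A pendent vertex is a vertex of degree $1$; $p$ is the number of pendent vertices. $AG(G)=\sum_{i\sim j}\frac12\left(\sqrt{d_i/d_j}+\sqrt{d_j/d_i}\right)$.
   Formalization: The formal theorem assumes n ≥ 3: for n = 2 (G = K_2, m = 1, p = 2) AG = 1 exceeds the stated bound 2 − 3√2/4 ≈ 0.939, and for n = 1 the bound divides by √(n−1) = 0. *)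

(* Defs.v *)
From HB Require Import structures.
From mathcomp Require Import all_boot all_order all_algebra.

Set Implicit Arguments.
Unset Strict Implicit.
Unset Printing Implicit Defensive.

Import Order.TTheory GRing.Theory Num.Theory.

Record sgraph (V : finType) := SGraph {
  adj : rel V;
  adj_sym : symmetric adj;
  adj_irrefl : irreflexive adj
}.

Section Graph.
Variables (V : finType) (G : sgraph V).

Definition degree (v : V) : nat := #|[set w | adj G v w]|.

Definition pendent : {set V} := [set v | degree v == 1].

(* Each undirected edge is represented once, by the ordered pair of its ends
   that is increasing for the enumeration of V. *)
Definition edges : {set V * V} :=
  [set e | adj G e.1 e.2 & enum_rank e.1 < enum_rank e.2].

Definition connected : Prop :=
  0 < #|V| /\ forall u v : V, connect (adj G) u v.

End Graph.

Definition isomorphic (V W : finType) (G : sgraph V) (H : sgraph W) : Prop :=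
  exists f : V -> W,
    bijective f /\ forall u v, adj H (f u) (f v) = adj G u v.

Definition complete_adj (n : nat) : rel 'I_n := fun i j => i != j.

Fact complete_adj_sym n : symmetric (@complete_adj n).
Proof. by move=> i j; rewrite /complete_adj eq_sym. Qed.

Fact complete_adj_irrefl n : irreflexive (@complete_adj n).
Proof. by move=> i; rewrite /complete_adj eqxx. Qed.

Definition complete_graph (n : nat) : sgraph 'I_n :=
  SGraph (@complete_adj_sym n) (@complete_adj_irrefl n).

Definition bipartite_adj (a b : nat) : rel ('I_a + 'I_b)%type :=
  fun x y => match x, y with
             | inl _, inr _ | inr _, inl _ => true
             | _, _ => false
             end.

Fact bipartite_adj_sym a b : symmetric (@bipartite_adj a b).
Proof. by case=> i [] j. Qed.

Fact bipartite_adj_irrefl a b : irreflexive (@bipartite_adj a b).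
Proof. by case. Qed.

Definition complete_bipartite_graph (a b : nat) : sgraph ('I_a + 'I_b)%type :=
  SGraph (@bipartite_adj_sym a b) (@bipartite_adj_irrefl a b).

Local Open Scope ring_scope.

Definition AG (R : rcfType) (V : finType) (G : sgraph V) : R :=
  \sum_(e in edges G)
    1 / 2 * (Num.sqrt ((degree G e.1)%:R / (degree G e.2)%:R)
             + Num.sqrt ((degree G e.2)%:R / (degree G e.1)%:R)).

(* Main.v *)
(** For [0 < k <= a, b <= N] the edge weight [sqrt (a/b) + sqrt (b/a)] is at most
    [sqrt (N/k) + sqrt (k/N)], with equality iff [{a, b} = {k, N}], because
    [s + 1/s] increases for [s >= 1].  With [N = n - 1], this is applied with
    [k = 1] to the edges having a pendent end, of which there are exactly [p]
    since [n >= 3], and with [k = 2] to the others.  Equality forces it on every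
    edge.  If an edge [uv] without pendent end exists, say [d(u) = n - 1] and
    [d(v) = 2], the second neighbour [w] of [v] closes a triangle whose edges
    force [n - 1 = 2]; otherwise the graph is a star. *)
Require Import Defs.
From HB Require Import structures.
From mathcomp Require Import all_boot all_order all_algebra.
From mathcomp Require Import ring lra zify.

Set Implicit Arguments.
Unset Strict Implicit.
Unset Printing Implicit Defensive.

Import Order.TTheory GRing.Theory Num.Theory.
Local Open Scope ring_scope.

(** * Extremal values of the weight of an edge *)

Section EdgeWeight.
Variable R : rcfType.

Definition weight (a b : nat) : R :=
  Num.sqrt (a%:R / b%:R) + Num.sqrt (b%:R / a%:R).

Definition extremal (k N a b : nat) : bool :=
  ((a == k) && (b == N)) || ((a == N) && (b == k)).

Lemma weightC a b : weight a b = weight b a.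
Proof. exact: addrC. Qed.

Lemma extremalC k N a b : extremal k N a b = extremal k N b a.
Proof. by rewrite /extremal orbC andbC; congr (_ || _); rewrite andbC. Qed.

(** The difference of the two sides factors as [(t - s) * (s * t - 1) / (s * t)], and
    [s * t >= 1]. *)
Lemma addr_inv_mono (s t : R) : 1 <= s -> s <= t ->
  s + s^-1 <= t + t^-1 ?= iff (s == t).
Proof.
move=> s1 st; have s0 : 0 < s by lra.
have t0 : 0 < t by lra.
have E : t + t^-1 - (s + s^-1) = (t - s) * (s * t - 1) / (s * t).
  by field; rewrite !gt_eqF.
have st0 : 0 < s * t by rewrite mulr_gt0.
have st1 : 1 <= s * t by nra.
split; first by rewrite -subr_ge0 E divr_ge0 ?mulr_ge0 ?subr_ge0 // ltW.
apply/eqP/eqP => [H|-> //].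
move: E; rewrite H subrr => /esym/eqP.
rewrite !mulf_eq0 invr_eq0 (gt_eqF st0) orbF => /orP[|] /eqP ?; first by lra.
(* Here [s * t = 1], which with [1 <= s <= t] forces [s = t = 1]. *)
by nra.
Qed.

Lemma weight_extremal (k N a b : nat) : (0 < k)%N ->
  (k <= a <= N)%N -> (k <= b <= N)%N ->
  weight a b <= weight N k ?= iff extremal k N a b.
Proof.
(* Ordering the degrees makes [sqrt (a/b) >= 1], the range where [s + 1/s] increases. *)
move=> k0; wlog ab : a b / (b <= a)%N => [th|] ha hb.
  case/orP: (leq_total b a) => ?; first exact: th.
  by rewrite weightC extremalC; apply: th.
have [b0 a0 N0] : [/\ 0 < b, 0 < a & 0 < N]%N by split; lia.
have wE x y : (0 < x)%N -> (0 < y)%N ->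
    weight x y = Num.sqrt (x%:R / y%:R) + (Num.sqrt (x%:R / y%:R))^-1.
  by move=> x0 y0; rewrite /weight -sqrtrV ?divr_ge0 ?ler0n // invf_div.
rewrite !wE //.
have h1 : 1 <= Num.sqrt (a%:R / b%:R : R).
  by rewrite -[X in X <= _]sqrtr1 ler_wsqrtr // ler_pdivlMr ?ltr0n // mul1r ler_nat.
have h2 : Num.sqrt (a%:R / b%:R : R) <= Num.sqrt (N%:R / k%:R).
  apply: ler_wsqrtr; rewrite ler_pdivrMr ?ltr0n // mulrAC ler_pdivlMr ?ltr0n //.
  by rewrite -!natrM ler_nat leq_mul //; lia.
have := addr_inv_mono h1 h2; congr (_ <= _ ?= iff _).
rewrite eqr_sqrt ?divr_ge0 ?ler0n // eqr_div ?pnatr_eq0 -?lt0n //.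
rewrite -!natrM eqr_nat /extremal.
(* Equality now reads [a * k = N * b]; since [a * k <= N * k <= N * b], it pins down both [a = N]
   and [b = k]. *)
apply/eqP/idP => [H|]; last first.
  case/orP=> /andP[/eqP ak /eqP bN]; last by rewrite ak bN.
  have Nk : N = k by lia.
  by rewrite ak bN Nk.
have /eqP -> : a == N by nia.
have /eqP -> : b == k by nia.
by rewrite !eqxx orbT.
Qed.

End EdgeWeight.

(** * Degrees in the model graphs, and recognition of complete graphs and stars *)

Section Isomorphism.

Lemma isomorphic_sym (V W : finType) (G : sgraph V) (H : sgraph W) :
  isomorphic G H -> isomorphic H G.
Proof.
case=> f [[g fK gK] fadj]; exists g; split; first by exists f.
by move=> u v; rewrite -fadj !gK.
Qed.

Lemma isomorphic_degree (V W : finType) (G : sgraph V) (H : sgraph W)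
    (f : V -> W) : bijective f -> (forall u v, adj H (f u) (f v) = adj G u v) ->
  forall u, degree H (f u) = degree G u.
Proof.
move=> fbij fadj u; rewrite /degree -(card_imset _ (bij_inj fbij)).
apply: eq_card => w; rewrite inE; have [g _ gK] := fbij.
rewrite -(gK w) (mem_imset _ _ (bij_inj fbij)) inE.
exact: fadj.
Qed.

Lemma degree_complete n (i : 'I_n) : degree (complete_graph n) i = n.-1.
Proof.
rewrite /degree -[in RHS](card_ord n) -(cardC1 i).
by apply: eq_card => j; rewrite !inE eq_sym.
Qed.

Lemma degree_bipartite_inl a b (i : 'I_a) :
  degree (complete_bipartite_graph a b) (inl i) = b.
Proof.
rewrite /degree -[RHS]card_ord -[RHS](card_imset _ (@inr_inj 'I_a 'I_b)).
apply: eq_card => -[j|j]; rewrite inE /=; last by rewrite imset_f.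
by apply/esym/imsetP => -[].
Qed.

Lemma degree_bipartite_inr a b (i : 'I_b) :
  degree (complete_bipartite_graph a b) (inr i) = a.
Proof.
rewrite /degree -[RHS]card_ord -[RHS](card_imset _ (@inl_inj 'I_a 'I_b)).
apply: eq_card => -[j|j]; rewrite inE /=; first by rewrite imset_f.
by apply/esym/imsetP => -[].
Qed.

Lemma isomorphic_complete (V : finType) (G : sgraph V) :
  (forall u v, adj G u v = (u != v)) -> isomorphic G (complete_graph #|V|).
Proof.
move=> Gadj; exists enum_rank; split; first exact: enum_rank_bij.
by move=> u v; rewrite Gadj /= /complete_adj (inj_eq enum_rank_inj).
Qed.

Lemma isomorphic_star (V : finType) (G : sgraph V) (c : V) :
  (forall u v, adj G u v = ((u == c) (+) (v == c))) ->
  isomorphic G (complete_bipartite_graph 1 (#|V| - 1)).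
Proof.
(* The map is built from the star to [G]: the left vertex goes to [c], the right ones enumerate the
   complement of [c]. *)
move=> Gadj; apply: isomorphic_sym.
have sz : size (enum [set~ c]) = (#|V| - 1)%N.
  by rewrite -cardE cardsC1 subn1.
have nc (i : 'I_(#|V| - 1)) : nth c (enum [set~ c]) i != c.
  by have := mem_nth c (eq_ind_r (fun s => i < s)%N (ltn_ord i) sz);
    rewrite mem_enum !inE.
pose f (x : 'I_1 + 'I_(#|V| - 1)) :=
  if x is inr i then nth c (enum [set~ c]) i else c.
have finj : injective f.
  move=> [i|i] [j|j] /=.
  - by rewrite (ord1 i) (ord1 j).
  - by move=> E; have := nc j; rewrite -E eqxx.
  - by move=> E; have := nc i; rewrite E eqxx.
  move/eqP; rewrite nth_uniq ?sz ?enum_uniq // => /eqP E.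
  by congr inr; apply: val_inj.
exists f; split.
  apply: inj_card_bij => //; rewrite card_sum !card_ord.
  by have := max_card (pred1 c); rewrite card1; lia.
move=> [i|i] [j|j] /=; rewrite Gadj ?eqxx //.
- by rewrite (negPf (nc j)).
- by rewrite (negPf (nc i)).
by rewrite (negPf (nc i)) (negPf (nc j)).
Qed.

End Isomorphism.

(** * Degrees, pendent ends and extremal edges *)

Section Degrees.
Variables (V : finType) (G : sgraph V).

Lemma degree_le_pred_order v : (degree G v <= #|V| - 1)%N.
Proof.
rewrite subn1 -(cardC1 v); apply/subset_leq_card/subsetP => w.
by rewrite !inE; apply: contraTneq => ->; rewrite adj_irrefl.
Qed.

Lemma adj_degree_gt0 u v : adj G u v -> (0 < degree G u)%N.
Proof. by move=> uv; apply/card_gt0P; exists v; rewrite inE. Qed.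

Lemma degree1_adj u v w : degree G u = 1%N -> adj G u v -> adj G u w -> v = w.
Proof.
move=> /eqP/cards1P[x E] uv uw.
have /set1P-> : v \in [set x] by rewrite -E inE.
by have /set1P-> : w \in [set x] by rewrite -E inE.
Qed.

(** The neighbours of [u] lie in the complement of [u], which has just as many elements, so they
    fill it. *)
Lemma dominating_adj u v : degree G u = (#|V| - 1)%N -> adj G u v = (u != v).
Proof.
move=> du; have sub : [set w | adj G u w] \subset [set~ u].
  apply/subsetP => w.
  by rewrite !inE; apply: contraTneq => ->; rewrite adj_irrefl.
have /setP/(_ v) : [set w | adj G u w] = [set~ u].
  apply/eqP; rewrite eqEcard sub cardsC1 -subn1.
  by rewrite -/(degree G u) du leqnn.
by rewrite !inE eq_sym.
Qed.

Definition has_pendent_end (u v : V) : bool :=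
  (degree G u == 1%N) || (degree G v == 1%N).

(** The [k] with which [weight_extremal] is applied to the edge [uv]. *)
Definition low_degree (u v : V) : nat := (if has_pendent_end u v then 1 else 2)%N.

Definition extremal_edge (u v : V) : bool :=
  extremal (low_degree u v) (#|V| - 1) (degree G u) (degree G v).

Lemma low_degreeC u v : low_degree u v = low_degree v u.
Proof. by rewrite /low_degree /has_pendent_end orbC. Qed.

Lemma extremal_edgeC u v : extremal_edge u v = extremal_edge v u.
Proof. by rewrite /extremal_edge extremalC low_degreeC. Qed.

Lemma low_degree_bounds u v : adj G u v ->
  (low_degree u v <= degree G u <= #|V| - 1)%N &&
  (low_degree u v <= degree G v <= #|V| - 1)%N.
Proof.
move=> uv; have vu : adj G v u by rewrite adj_sym.
rewrite !degree_le_pred_order !andbT /low_degree /has_pendent_end.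
have := adj_degree_gt0 uv; have := adj_degree_gt0 vu.
by case: eqP; case: eqP; move=> /=; lia.
Qed.

Definition oriented (u v : V) : V * V :=
  if (enum_rank u < enum_rank v)%N then (u, v) else (v, u).

Lemma oriented_edge u v : adj G u v -> oriented u v \in edges G.
Proof.
move=> uv; rewrite /oriented inE; case: ltnP => /= [|le]; first by rewrite uv.
rewrite adj_sym uv /= ltn_neqAle le andbT.
apply: contraTneq uv => /val_inj/enum_rank_inj ->.
by rewrite adj_irrefl.
Qed.

(** Extremality is symmetric in the two ends, so the orientation chosen in [edges] is immaterial. *)
Lemma forall_edges_extremal :
  reflect (forall u v, adj G u v -> extremal_edge u v)
          [forall e in edges G, extremal_edge e.1 e.2].
Proof.
apply: (iffP forall_inP) => [H u v uv|H e]; last by rewrite inE => /andP[/H].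
by have := H _ (oriented_edge uv); rewrite /oriented; case: ifP => //= _;
  rewrite extremal_edgeC.
Qed.

Lemma star_extremal_edge u v :
  isomorphic G (complete_bipartite_graph 1 (#|V| - 1)) ->
  adj G u v -> extremal_edge u v.
Proof.
move=> [f [fbij fadj]].
rewrite -fadj /extremal_edge /low_degree /has_pendent_end.
rewrite -!(isomorphic_degree fbij fadj).
case: (f u) (f v) => [i|i] [j|j] //= _;
  by rewrite degree_bipartite_inl degree_bipartite_inr /extremal !eqxx ?orbT.
Qed.

Lemma K3_extremal_edge u v :
  isomorphic G (complete_graph 3) -> adj G u v -> extremal_edge u v.
Proof.
move=> [f [fbij fadj]] _.
rewrite /extremal_edge /low_degree /has_pendent_end.
rewrite -!(isomorphic_degree fbij fadj) !degree_complete.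
by rewrite (bij_eq_card fbij) card_ord.
Qed.

Hypotheses (G_conn : connected G) (V_ge3 : (3 <= #|V|)%N).

Lemma exists_adj u : exists v, adj G u v.
Proof.
have [v vu] : exists v, v != u.
  have /card_gt0P[v] : (0 < #|predC1 u|)%N by rewrite cardC1; lia.
  by rewrite !inE; exists v.
have /connectP[[|w p] /= up E] := proj2 G_conn u v.
  by rewrite E eqxx in vu.
by case/andP: up; exists w.
Qed.

(** Otherwise [{u, v}] would be closed under adjacency, hence all of [V] by connectedness, against
    [#|V| >= 3]. *)
Lemma adj_not_both_pendent u v : adj G u v ->
  ~~ ((degree G u == 1%N) && (degree G v == 1%N)).
Proof.
move=> uv; apply/negP => /andP[/eqP du /eqP dv].
have vu : adj G v u by rewrite adj_sym.
have cl : closed (adj G) [set u; v].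
  apply: intro_closed; first exact: (sym_connect_sym (@adj_sym _ G)).
  move=> x y xy; rewrite !inE => /orP[]/eqP ?; subst x.
    by rewrite (degree1_adj du xy uv) eqxx orbT.
  by rewrite (degree1_adj dv xy vu) eqxx.
have : (#|V| <= #|[set u; v]|)%N.
  rewrite -cardsT; apply/subset_leq_card/subsetP => x _.
  by rewrite -(closed_connect cl (proj2 G_conn u x)) !inE eqxx.
by rewrite cards2; move: V_ge3; case: eqP => _; lia.
Qed.

(** Sending such an edge to its pendent end is a bijection: a pendent vertex lies on exactly one
    edge, whose other end is not pendent. *)
Lemma card_edges_pendent :
  #|[set e in edges G | has_pendent_end e.1 e.2]| = #|pendent G|.
Proof.
pose f (e : V * V) := if degree G e.1 == 1%N then e.1 else e.2.
rewrite -(@card_in_imset _ _ f).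
  apply: eq_card => v; apply/imsetP/idP => [[[x y] /=]|].
    rewrite !inE /has_pendent_end /f /= => /andP[_] /orP[] H ->.
      by rewrite H.
    by case: ifP.
  rewrite inE => dv; have [w vw] := exists_adj v.
  exists (oriented v w); have := adj_not_both_pendent vw.
    rewrite inE oriented_edge //= /oriented /has_pendent_end.
    by case: ifP => _ /=; rewrite dv ?orbT.
  rewrite dv /= => /negPf dw; rewrite /f /oriented.
  by case: ltnP => _ /=; rewrite ?dv ?dw.
move=> [x y] [z t]; rewrite !inE /has_pendent_end /f /=.
move=> /andP[/andP[xy lxy] pxy] /andP[/andP[zt lzt] pzt].
have yx : adj G y x by rewrite adj_sym.
have tz : adj G t z by rewrite adj_sym.
(* In the two mixed cases the pairs would be reverses of each other, which the rank order
   forbids. *)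
case: eqP pxy => [dx _|_ /eqP dy]; case: eqP pzt => [dz _|_ /eqP dt] E; subst.
- by rewrite (degree1_adj dx xy zt).
- by have E := degree1_adj dx xy tz; subst; lia.
- by have E := degree1_adj dy yx zt; subst; lia.
- by rewrite (degree1_adj dy yx tz).
Qed.

Lemma extremal_classification : (forall u v, adj G u v -> extremal_edge u v) ->
  isomorphic G (complete_bipartite_graph 1 (#|V| - 1)) \/
  isomorphic G (complete_graph 3).
Proof.
move=> ext.
have [/existsP[u /existsP[v /andP[uv]]]|] :=
  boolP [exists u, exists v, adj G u v && ~~ has_pendent_end u v].
  wlog du : u v uv / degree G u = (#|V| - 1)%N /\ degree G v = 2%N => [th|].
    move=> np; have := ext _ _ uv; rewrite /extremal_edge /low_degree (negPf np).
    case/orP => /andP[/eqP d1 /eqP d2]; last exact: (th u v).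
    by apply: (th v u); rewrite // 1?adj_sym // /has_pendent_end orbC.
  case: du => du dv _; right.
  have uNv : u != v by rewrite -dominating_adj.
  have vu : adj G v u by rewrite adj_sym.
  (* [v] has degree 2, so it has a neighbour besides [u]; as [u] is adjacent to every other vertex,
     [u], [v], [w] form a triangle. *)
  have [w wu vw] : exists2 w, w != u & adj G v w.
    have /card_gt0P[w] : (0 < #|[set w | adj G v w] :\ u|)%N.
      by have := cardsD1 u [set w | adj G v w]; rewrite -/(degree G v) inE vu; lia.
    by rewrite !inE => /andP[]; exists w.
  have uw : adj G u w by rewrite dominating_adj // eq_sym.
  have wNv : w != v by apply: contraTneq vw => ->; rewrite adj_irrefl.
  have dw1 : degree G w != 1%N.
    apply/eqP => dw; move/eqP: uNv; apply.
    by apply: (degree1_adj dw); rewrite adj_sym.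
  have du1 : degree G u != 1%N by rewrite du; lia.
  have dw : degree G w = 2%N.
    have := ext _ _ uw; rewrite /extremal_edge /low_degree /has_pendent_end.
    rewrite (negPf du1) (negPf dw1) /extremal /= du.
    by case/orP=> /andP[/eqP N2 /eqP dwE] //; rewrite dwE N2.
  (* Both ends of [vw] have degree 2, so its extremality gives [#|V| - 1 = 2]. *)
  have V3 : #|V| = 3%N.
    have := ext _ _ vw; rewrite /extremal_edge /low_degree /has_pendent_end.
    by rewrite dv dw /extremal /=; lia.
  have uvw x : x \in [set u; v; w].
    suff -> : [set u; v; w] = setT by rewrite inE.
    apply/eqP; rewrite eqEcard subsetT cardsT V3 /=.
    by rewrite setUC cardsU1 cards2 !inE negb_or wu wNv uNv.
  rewrite -V3; apply: isomorphic_complete => x y; apply: dominating_adj.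
  by have := uvw x; rewrite !inE -orbA => /or3P[]/eqP->; rewrite ?du ?dv ?dw V3.
rewrite negb_exists => /forallP np.
have pend u v : adj G u v -> has_pendent_end u v.
  by move=> uv; have := np u; rewrite negb_exists => /forallP/(_ v);
    rewrite uv /= negbK.
have ext1 u v : adj G u v -> extremal 1 (#|V| - 1) (degree G u) (degree G v).
  by move=> uv; have := ext _ _ uv; rewrite /extremal_edge /low_degree pend.
(* Any edge has an end of maximal degree; it serves as the centre of the star. *)
have [c dc] : exists c, degree G c = (#|V| - 1)%N.
  have /card_gt0P[u _] : (0 < #|V|)%N by lia.
  have [v uv] := exists_adj u.
  by case/orP: (ext1 _ _ uv) => /andP[/eqP ? /eqP ?]; [exists v|exists u].
left; apply: (@isomorphic_star _ _ c) => x y.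
have cE z : adj G c z = (c != z) by exact: dominating_adj.
case: (x =P c) => [->|/eqP xc]; first by rewrite cE eq_sym; case: eqP.
case: (y =P c) => [->|/eqP yc] /=; first by rewrite adj_sym cE eq_sym.
have cx : adj G c x by rewrite cE eq_sym.
have dx : degree G x = 1%N by have := ext1 _ _ cx; rewrite /extremal dc; lia.
(* The only neighbour of the pendent vertex [x] is [c], so no edge avoids [c]. *)
apply/negP => xy; move/eqP: yc; apply.
by apply: (degree1_adj dx) => //; rewrite adj_sym.
Qed.

End Degrees.

(** * Summation over the edges *)

Lemma weight1 (R : rcfType) n : (1 < n)%N ->
  weight R (n - 1) 1 = n%:R / Num.sqrt (n%:R - 1).
Proof.
move=> n1; have n0 : 0 < n%:R - 1 :> R by rewrite subr_gt0 ltr1n.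
rewrite /weight (natrB _ (ltnW n1)) mulr1n divr1 mul1r (sqrtrV (ltW n0)).
have s0 : Num.sqrt (n%:R - 1) != 0 :> R by rewrite gt_eqF // sqrtr_gt0.
(* Multiplied by [sqrt (n - 1)], the identity becomes [(n - 1) + 1 = n]. *)
apply: (mulIf s0); rewrite mulrDl mulVf // divfK // -expr2 (sqr_sqrtr (ltW n0)).
by rewrite subrK.
Qed.

(** The condition [n_ge3] excludes [K_2], whose single edge has two pendent ends and for which the
    inequality fails. *)
Theorem theorem3 (R : rcfType) (V : finType) (G : sgraph V) (n m p : nat)
    (G_conn : connected G) (order_G : #|V| = n) (n_ge3 : (3 <= n)%N)
    (size_G : #|edges G| = m) (pendent_G : #|pendent G| = p) :
  let bound : R :=
    1 / 2 * p%:R * (n%:R / Num.sqrt (n%:R - 1))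
    + 1 / 2 * (m%:R - p%:R)
      * (Num.sqrt ((n%:R - 1) / 2) + Num.sqrt (2 / (n%:R - 1))) in
  AG R G <= bound /\
  (AG R G = bound <->
   isomorphic G (complete_bipartite_graph 1 (n - 1)) \/
   isomorphic G (complete_graph 3)).
Proof.
move=> bound; subst n.
have boundE : bound = 1 / 2 *
    \sum_(e in edges G) weight R (#|V| - 1) (low_degree G e.1 e.2).
  rewrite (bigID (fun e => has_pendent_end G e.1 e.2)) /=.
  rewrite (eq_bigr (fun=> weight R (#|V| - 1) 1)); last first.
    by move=> e /andP[_ pe]; rewrite /low_degree pe.
  rewrite [X in _ + X](eq_bigr (fun=> weight R (#|V| - 1) 2)); last first.
    by move=> e /andP[_ /negPf pe]; rewrite /low_degree pe.
  rewrite !sumr_const.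
  (* [a] and [b] count the edges with and without a pendent end, so [a = p] and [b = m - p]. *)
  set a := #|_|; set b := #|_|.
  have ap : a = p.
    rewrite -pendent_G -(card_edges_pendent G_conn n_ge3).
    by apply: eq_card => e; rewrite inE.
  have abm : (a + b)%N = m.
    rewrite -size_G -(cardID (fun e => has_pendent_end G e.1 e.2) (edges G)).
    by congr (_ + _)%N; apply: eq_card => e; apply: andbC.
  have mpb : m%:R - p%:R = b%:R :> R by rewrite -abm ap natrD addrC addKr.
  rewrite ap weight1; last by lia.
  have -> : weight R (#|V| - 1) 2 = Num.sqrt ((#|V|%:R - 1) / 2)
      + Num.sqrt (2 / (#|V|%:R - 1)) by rewrite /weight natrB //; lia.
  rewrite /bound mpb -(mulr_natl _ p) -(mulr_natl _ b); ring.
have AGE : AG R G = 1 / 2 *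
    \sum_(e in edges G) weight R (degree G e.1) (degree G e.2).
  by rewrite mulr_sumr.
(* Edgewise comparison: the sums agree exactly when every term does. *)
have [le_sum eq_sum] :
    \sum_(e in edges G) weight R (degree G e.1) (degree G e.2)
    <= \sum_(e in edges G) weight R (#|V| - 1) (low_degree G e.1 e.2)
    ?= iff [forall e in edges G, extremal_edge G e.1 e.2].
  apply: leif_sum => e; rewrite inE => /andP[uv _].
  have /andP[b1 b2] := low_degree_bounds uv.
  by apply: weight_extremal => //; rewrite /low_degree; case: ifP.
have half_gt0 : 0 < 1 / 2 :> R by lra.
rewrite boundE AGE ler_pM2l //; split=> //; split.
  move/(mulfI (lt0r_neq0 half_gt0))/eqP; rewrite eq_sum.
  by move/forall_edges_extremal/(extremal_classification G_conn n_ge3).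
move=> iso; congr (_ * _); apply/eqP; rewrite eq_sum.
apply/forall_edges_extremal => u v uv.
by case: iso => [/star_extremal_edge|/K3_extremal_edge]; apply.
Qed.
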